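(* Let $\Sigma$, $U$ be real Hilbert spaces, $a:\Sigma\times\Sigma\to\mathbb{R}$ a bounded symmetric bilinear form, $b:\Sigma\times U\to\mathbb{R}$ a bounded bilinear form, $g\in\Sigma^*$, $f\in U^*$. Let $\Sigma_h\subset\Sigma_{h/2}\subset\Sigma$ and $U_h\subset U_{h/2}\subset U$ be finite-dimensional subspaces with inclusions $I_h:\Sigma_h\to\Sigma_{h/2}$ and $J_h:U_h\to U_{h/2}$. Let $(\sigma,u)\in\Sigma\times U$ satisfy $$a(\sigma,\tau)+b(\tau,u)=g(\tau)\ \ \forall\tau\in\Sigma,\qquad b(\sigma,v)=f(v)\ \ \forall v\in U,$$ and let $(\sigma_h,u_h)\in\Sigma_h\times U_h$ and $(\sigma_{h/2},u_{h/2})\in\Sigma_{h/2}\times U_{h/2}$ be the Galerkin solutions, i.e. they satisfy the same equations with $(\Sigma,U)$ replaced by $(\Sigma_h,U_h)$ and $(\Sigma_{h/2},U_{h/2})$, respectively. Assume: (i) (boundedness and inf-sup stability) with $\mathcal{B}(\tau_1,v_1;\tau_2,v_2):=a(\tau_1,\tau_2)+b(\tau_2,v_1)+b(\tau_1,v_2)$, there are constants $\alpha_{h/2},\beta_{h/2}>0$ such that for all $(\tau_1,v_1),(\tau_2,v_2)\in\Sigma_{h/2}\times U_{h/2}$ $$\mathcal{B}(\tau_1,v_1;\tau_2,v_2)\le\alpha_{h/2}\|(\tau_1,v_1)\|_{\Sigma\times U}\|(\tau_2,v_2)\|_{\Sigma\times U},$$ and for all $(\tau_1,v_1)\in\Sigma_{h/2}\times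 U_{h/2}$ $$\sup_{(\tau_2,v_2)\in\Sigma_{h/2}\times U_{h/2},\ \|(\tau_2,v_2)\|_{\Sigma\times U}=1}\mathcal{B}(\tau_1,v_1;\tau_2,v_2)\ge\beta_{h/2}\|(\tau_1,v_1)\|_{\Sigma\times U};$$ (ii) (saturation) $\|(\sigma-\sigma_{h/2},u-u_{h/2})\|_{\Sigma\times U}\le\gamma_{h/2}\|(\sigma-\sigma_h,u-u_h)\|_{\Sigma\times U}$ for some $0\le\gamma_{h/2}<1$; (iii) (preconditioners) for linear operators $S_{\Sigma_{h/2}}:\Sigma_{h/2}^*\to\Sigma_{h/2}$ and $S_{U_{h/2}}:U_{h/2}^*\to U_{h/2}$, the operators $$B_{\Sigma_{h/2}}=I_hA_{\Sigma_h}^{-1}I_h^*+S_{\Sigma_{h/2}},\qquad B_{U_{h/2}}=J_hA_{U_h}^{-1}J_h^*+S_{U_{h/2}}$$ satisfy, with constants $c_2,c_3,c_4,c_5>0$, $$c_2\langle r_1,B_{\Sigma_{h/2}}r_1\rangle\le\langle r_1,A_{\Sigma_{h/2}}^{-1}r_1\rangle\le c_3\langle r_1,B_{\Sigma_{h/2}}r_1\rangle\quad\forall r_1\in\Sigma_{h/2}^*,$$ $$c_4\langle r_2,B_{U_{h/2}}r_2\rangle\le\langle r_2,A_{U_{h/2}}^{-1}r_2\rangle\le c_5\langle r_2,B_{U_{h/2}}r_2\rangle\quad\forall r_2\in U_{h/2}^*.$$ Define the residuals $r_\sigma\in\Sigma_{h/2}^*$, $r_u\in U_{h/2}^*$ by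 $$\langle r_\sigma,\tau\rangle:=g(\tau)-a(\sigma_h,\tau)-b(\tau,u_h),\ \tau\in\Sigma_{h/2};\qquad\langle r_u,v\rangle:=f(v)-b(\sigma_h,v),\ v\in U_{h/2}.$$ Then $$\frac{\sqrt{\min(c_2,c_4)}}{\alpha_{h/2}(1+\gamma_{h/2})}\,\mathcal{E}_h(\sigma_h,u_h)\le\|(\sigma-\sigma_h,u-u_h)\|_{\Sigma\times U}\le\frac{\sqrt{\max(c_3,c_5)}}{\beta_{h/2}(1-\gamma_{h/2})}\,\mathcal{E}_h(\sigma_h,u_h),$$ where $$\mathcal{E}_h(\sigma_h,u_h)=\sqrt{\langle r_\sigma,B_{\Sigma_{h/2}}r_\sigma\rangle+\langle r_u,B_{U_{h/2}}r_u\rangle}=\sqrt{\langle r_\sigma,S_{\Sigma_{h/2}}r_\sigma\rangle+\langle r_u,S_{U_{h/2}}r_u\rangle}.$$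
   Context: For a space $W$, $W^*$ is its dual and $\langle\cdot,\cdot\rangle$ the duality pairing; $T^*:W_2^*\to W_1^*$ denotes the adjoint of $T:W_1\to W_2$. The product norm is $\|(\tau,v)\|_{\Sigma\times U}:=(\|\tau\|_\Sigma^2+\|v\|_U^2)^{1/2}$. For $\ell\in\{h,h/2\}$, the operators $A_{\Sigma_\ell}:\Sigma_\ell\to\Sigma_\ell^*$ and $A_{U_\ell}:U_\ell\to U_\ell^*$ are the symmetric positive-definite operators representing the inner products of $\Sigma_\ell$ and $U_\ell$, i.e. $\langle A_{\Sigma_\ell}\tau_1,\tau_2\rangle=(\tau_1,\tau_2)_\Sigma$ for $\tau_1,\tau_2\in\Sigma_\ell$ and $\langle A_{U_\ell}v_1,v_2\rangle=(v_1,v_2)_U$ for $v_1,v_2\in U_\ell$; in particular $\|\tau\|_\Sigma^2=\langle A_{\Sigma_\ell}\tau,\tau\rangle$ on $\Sigma_\ell$ and $\|v\|_U^2=\langle A_{U_\ell}v,v\rangle$ on $U_\ell$. *)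

(* Defs.v *)
From HB Require Import structures.
From mathcomp Require Import all_boot all_order all_algebra.
From mathcomp Require Import sesquilinear.
From mathcomp Require Import all_classical all_reals all_analysis.

Set Implicit Arguments.
Unset Strict Implicit.
Unset Printing Implicit Defensive.

Import Order.TTheory GRing.Theory Num.Theory.
Import numFieldNormedType.Exports.

Local Open Scope ring_scope.

HB.mixin Record CompleteNormedModule_isHilbert (R : realType) (V : Type)
    of CompleteNormedModule R V := {
  inner : {dot V for (@idfun R)} ;
  sqr_norm_inner : forall x : V, `|x| ^+ 2 = inner x x
}.

#[short(type="hilbertType")]
HB.structure Definition Hilbert (R : realType) :=
  {V of CompleteNormedModule R V & CompleteNormedModule_isHilbert R V}.

Section InnerTheory.
Variables (R : realType) (V : hilbertType R).
Implicit Types x y z : V.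

Lemma innerC x y : inner x y = inner y x.
Proof. by have := @hermitian_subproof _ _ _ _ (@inner R V) x y; rewrite expr0 mul1r. Qed.

Lemma innerPr k x y z : inner x (k *: y + z) = k * inner x y + inner x z.
Proof. exact: linearPr. Qed.

Lemma innerPl k x y z : inner (k *: y + z) x = k * inner y x + inner z x.
Proof. by rewrite innerC innerPr !(innerC x). Qed.
End InnerTheory.

Definition bounded_bilinear (R : realType) (V W : normedModType R)
    (f : V -> W -> R) : Prop :=
  exists M : R, forall x y, `|f x y| <= M * (`|x| * `|y|).

Record fdsubspace (R : realType) (V : lmodType R) := FDSubspace {
  fds_pred :> {pred V} ;
  fds_closed : submod_closed fds_pred ;
  fds_finspan : exists n : nat, exists e : 'I_n -> V,
    (forall i, e i \in fds_pred) /\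
    (forall x, x \in fds_pred -> exists c : 'I_n -> R, x = \sum_i c i *: e i)
}.

Section FDSubspaceBasis.
Variables (R : realType) (V : lmodType R) (W : fdsubspace V).

Let spanned (n : nat) := exists e : 'I_n -> V,
  (forall i, e i \in fds_pred W) /\
  (forall x, x \in fds_pred W -> exists c : 'I_n -> R, x = \sum_i c i *: e i).

Lemma fds_basis : exists n : nat, exists e : 'I_n -> V,
  [/\ forall i, e i \in fds_pred W,
      forall x, x \in fds_pred W -> exists c : 'rV[R]_n, x = \sum_i c 0 i *: e i
    & forall c : 'rV[R]_n, \sum_i c 0 i *: e i = 0 -> c = 0].
Proof.
have exP : exists n, `[< spanned n >].
  by have [n [e he]] := fds_finspan W; exists n; apply/asboolP; exists e.
case: (ex_minnP exP) => n /asboolP[e [eW eS]] nmin; exists n, e; split=> //.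
  move=> x /eS[c ->]; exists (\row_i c i).
  by apply: eq_bigr => i _; rewrite mxE.
move=> c c0; apply/eqP/negPn/negP => /rV0Pn[i ci].
case: n i e c eW eS nmin c0 ci => [[]//|n] i e c eW eS nmin c0 ci.
suff /asboolP/nmin : spanned n by rewrite ltnn.
exists (e \o lift i); split=> [j|x xW]; first exact: eW.
have ei : e i = \sum_(j < n) (- (c 0 i)^-1 * c 0 (lift i j)) *: e (lift i j).
  move: c0; rewrite (bigD1_ord i) //= => /eqP; rewrite addrC addr_eq0 => /eqP c0.
  under eq_bigr do rewrite -scalerA.
  by rewrite -scaler_sumr c0 scalerN scaleNr opprK scalerA mulVf // scale1r.
have [d ->] := eS x xW.
exists (fun j => d i * (- (c 0 i)^-1 * c 0 (lift i j)) + d (lift i j)).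
rewrite (bigD1_ord i) //= ei scaler_sumr -big_split /=.
by apply: eq_bigr => j _; rewrite scalerDl scalerA.
Qed.

End FDSubspaceBasis.

Section FDSubspaceVector.
Variables (R : realType) (V : lmodType R) (W : fdsubspace V).

HB.instance Definition _ := GRing.isSubmodClosed.Build R V (fds_pred W)
  (fds_closed W).

Inductive fds_type : predArgType := FDS x & x \in fds_pred W.
Definition fdsval (w : fds_type) : V := let: FDS x _ := w in x.

HB.instance Definition _ := [isSub of fds_type for fdsval].
HB.instance Definition _ := [Choice of fds_type by <:].
HB.instance Definition _ := [SubChoice_isSubZmodule of fds_type by <:].
HB.instance Definition _ := [SubZmodule_isSubLmodule of fds_type by <:].

Lemma fdsval_is_linear : linear fdsval. Proof. by []. Qed.
HB.instance Definition _ := GRing.isLinear.Build R fds_type V _ fdsval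
  fdsval_is_linear.

Lemma fdsval_inj : injective fdsval. Proof. exact: val_inj. Qed.
Lemma fdsvalP w : fdsval w \in fds_pred W. Proof. exact: valP. Qed.

Let dimW : nat := sval (cid (fds_basis W)).

Fact fds_vect_iso : Vector.axiom dimW fds_type.
Proof.
rewrite /dimW; case: cid => n /= /cid[e [eW eS eI]].
pose f (c : 'rV[R]_n) : fds_type := \sum_i c 0 i *: FDS (eW i).
have fE c : fdsval (f c) = \sum_i c 0 i *: e i.
  by rewrite raddf_sum /=; apply: eq_bigr.
have fI c d : f c = f d -> c = d.
  move=> cd; apply/eqP; rewrite -subr_eq0; apply/eqP/eI.
  under eq_bigr do rewrite !mxE scalerBl.
  by rewrite sumrB -!fE cd subrr.
have fS w : exists c, f c = w.
  by have [c cE] := eS _ (fdsvalP w); exists c; apply: fdsval_inj; rewrite fE.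
pose g w := sval (cid (fS w)).
have gK : cancel g f by move=> w; rewrite /g; case: cid.
have fK : cancel f g by move=> c; apply: fI; rewrite gK.
exists g; last by exists f.
move=> k u v; apply: fI; rewrite gK -{1}[u]gK -{1}[v]gK.
apply: fdsval_inj; rewrite linearP /= !fE scaler_sumr -big_split /=.
by apply: eq_bigr => i _; rewrite !mxE scalerDl scalerA.
Qed.

HB.instance Definition _ := Lmodule_hasFinDim.Build R fds_type fds_vect_iso.

End FDSubspaceVector.

Coercion fds_type : fdsubspace >-> predArgType.

Lemma linfun_linearE (R : realType) (X Y : vectType R) (f : X -> Y) :
  linear f -> linfun f =1 f.
Proof.
move=> fl; pose fL : {linear X -> Y} := HB.pack f (GRing.isLinear.Build R X Y _ f fl).
exact: (lfunE fL).
Qed.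

Definition dual (R : realType) (X : vectType R) := 'Hom(X, R^o).

Definition pairing (R : realType) (X : vectType R) (r : dual X) (x : X) : R := r x.

Section Adjoint.
Variables (R : realType) (X Y : vectType R) (T : 'Hom(X, Y)).

Definition adjoint : 'Hom(dual Y, dual X) :=
  linfun (fun r : dual Y => (r \o T)%VF : dual X).

Lemma adjointE (r : dual Y) x : pairing (adjoint r) x = pairing r (T x).
Proof.
rewrite /pairing linfun_linearE ?comp_lfunE // => k u v.
by rewrite comp_lfunDl comp_lfunZl.
Qed.
End Adjoint.

Section Inclusion.
Variables (R : realType) (V : lmodType R) (W1 W2 : fdsubspace V).
Hypothesis W12 : {subset W1 <= W2}.

Definition fdincl : 'Hom(W1, W2) := linfun (fun x : W1 => FDS (W12 (fdsvalP x))).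

Lemma fdinclE x : fdsval (fdincl x) = fdsval x.
Proof. by rewrite linfun_linearE // => k u v; apply: fdsval_inj. Qed.
End Inclusion.

(* [riesz_op W] is bijective, so the partial inverse [(riesz_op W)^-1%VF] of
   the library is its inverse: see [riesz_opK] and [riesz_opVK] *)
Section RieszOp.
Variables (R : realType) (V : hilbertType R) (W : fdsubspace V).

Definition riesz_op : 'Hom(W, dual W) := linfun (fun x : W =>
  linfun (fun y : W => inner (fdsval x) (fdsval y) : R^o) : dual W).

Lemma riesz_opE x y : pairing (riesz_op x) y = inner (fdsval x) (fdsval y).
Proof.
have lr (z : W) : linear (fun y : W => inner (fdsval z) (fdsval y) : R^o).
  by move=> k u v; exact: innerPr.
rewrite /pairing linfun_linearE ?linfun_linearE // => k u v.
apply/lfunP => z; rewrite add_lfunE scale_lfunE !linfun_linearE //.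
exact: innerPl.
Qed.

Lemma riesz_op_lker0 : lker riesz_op == 0%VS.
Proof.
apply/lker0P => x y xy; apply/eqP; rewrite -subr_eq0; apply/eqP/fdsval_inj.
have xy0 : riesz_op (x - y) = 0 by rewrite linearB /= xy subrr.
apply/eqP; rewrite -normr_eq0 -sqrf_eq0 sqr_norm_inner.
by rewrite -riesz_opE xy0 /pairing zero_lfunE.
Qed.

Lemma riesz_opK : cancel riesz_op riesz_op^-1%VF.
Proof. exact: lker0_lfunK riesz_op_lker0. Qed.

Lemma riesz_opVK : cancel riesz_op^-1%VF riesz_op.
Proof.
move=> r; apply: limg_lfunVK.
suff -> : limg riesz_op = fullv by exact: memvf.
apply/eqP; rewrite eqEdim subvf /= limg_dim_eq.
  by rewrite !dimvf /dim /= muln1.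
by rewrite (eqP riesz_op_lker0) capv0.
Qed.
End RieszOp.

Definition prod_norm (R : realType) (V W : normedModType R) (x : V) (y : W) : R :=
  Num.sqrt (`|x| ^+ 2 + `|y| ^+ 2).

Definition saddle_form (R : realType) (V W : lmodType R)
    (a : V -> V -> R) (b : V -> W -> R) (p q : V * W) : R :=
  a p.1 q.1 + b q.1 p.2 + b p.1 q.2.

(* Main.v *)
(* Riesz representatives turn the residual into an element of the fine space,
   whose norm is the dual norm of the residual. By Galerkin consistency on the
   fine space, the residual is the saddle-point form applied to the difference
   of the two discrete solutions, so boundedness and inf-sup stability make
   the norm of the residual equivalent to the norm of this difference, which
   saturation compares with the error. The preconditioner bounds pass from the
   Riesz norm to the estimator, and the coarse contribution to the estimator
   vanishes because the residual annihilates the coarse space. *)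
Require Import Defs.
From mathcomp Require Import all_boot all_order all_algebra.
From mathcomp Require Import sesquilinear.
From mathcomp Require Import all_classical all_reals all_analysis.
From mathcomp Require Import ring lra.
Set Implicit Arguments.
Unset Strict Implicit.
Import Order.TTheory GRing.Theory Num.Theory.
Import numFieldNormedType.Exports.
Local Open Scope classical_set_scope.
Local Open Scope ring_scope.

(** Expanding the squared norm of [|y| x - |x| y] gives [2 |x| |y| (|x| |y| - inner x y)], which is
    nonnegative; for nonzero vectors the positive factor cancels. *)
Lemma inner_le_norm (R : realType) (V : hilbertType R) (x y : V) :
  inner x y <= `|x| * `|y|.
Proof.
have [->|x0] := eqVneq x 0; first by rewrite innerC linear0r normr0 mul0r.
have [->|y0] := eqVneq y 0; first by rewrite linear0r normr0 mulr0.
have xy0 : 0 < `|x| * `|y| by rewrite mulr_gt0 ?normr_gt0.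
have innerZr k (z w : V) : inner z (k *: w) = k * inner z w.
  by rewrite -[k *: w]addr0 innerPr linear0r addr0.
have := sqr_ge0 `| `|y| *: x + (- `|x|) *: y|.
rewrite sqr_norm_inner innerPl innerPr innerZr.
rewrite (innerC (- `|x| *: y)) innerZr innerPl (innerC (- `|x| *: y)) innerZr.
rewrite -!sqr_norm_inner => h.
rewrite -subr_ge0 -(pmulr_rge0 _ xy0); lra.
Qed.

Section ProdNorm.
Variables (R : realType) (V W : normedModType R).
Implicit Types (x : V) (y : W).

Lemma sqr_prod_norm x y : prod_norm x y ^+ 2 = `|x| ^+ 2 + `|y| ^+ 2.
Proof. by rewrite /prod_norm sqr_sqrtr // addr_ge0 ?sqr_ge0. Qed.

Lemma prod_norm_ge0 x y : 0 <= prod_norm x y.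
Proof. exact: sqrtr_ge0. Qed.

Lemma prod_normN x y : prod_norm (- x) (- y) = prod_norm x y.
Proof. by rewrite /prod_norm !normrN. Qed.

(** By Lagrange's identity, the squares of the two sides differ by the square of
    [|x1| |y2| - |x2| |y1|]. *)
Lemma prod_norm_cauchy x1 y1 x2 y2 :
  `|x1| * `|x2| + `|y1| * `|y2| <= prod_norm x1 y1 * prod_norm x2 y2.
Proof.
rewrite -(@ler_pXn2r _ 2) ?nnegrE ?addr_ge0 ?mulr_ge0 ?prod_norm_ge0 //.
rewrite exprMn !sqr_prod_norm.
have := sqr_ge0 (`|x1| * `|y2| - `|x2| * `|y1|); lra.
Qed.

Lemma prod_normD x1 y1 x2 y2 :
  prod_norm (x1 + x2) (y1 + y2) <= prod_norm x1 y1 + prod_norm x2 y2.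
Proof.
rewrite -(@ler_pXn2r _ 2) ?nnegrE ?addr_ge0 ?prod_norm_ge0 //.
rewrite sqrrD !sqr_prod_norm.
have hx : `|x1 + x2| ^+ 2 <= (`|x1| + `|x2|) ^+ 2.
  by rewrite ler_pXn2r ?nnegrE ?addr_ge0 ?ler_normD.
have hy : `|y1 + y2| ^+ 2 <= (`|y1| + `|y2|) ^+ 2.
  by rewrite ler_pXn2r ?nnegrE ?addr_ge0 ?ler_normD.
have := prod_norm_cauchy x1 y1 x2 y2; lra.
Qed.

End ProdNorm.

Lemma inner_prod_cauchy (R : realType) (V W : hilbertType R)
    (x1 x2 : V) (y1 y2 : W) :
  inner x1 x2 + inner y1 y2 <= prod_norm x1 y1 * prod_norm x2 y2.
Proof.
apply: le_trans (prod_norm_cauchy x1 y1 x2 y2).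
by rewrite lerD ?inner_le_norm.
Qed.

Section Riesz.
Variables (R : realType) (V : hilbertType R).

Lemma inner_riesz_inv (W : fdsubspace V) (r : dual W) (x : W) :
  inner (fdsval ((riesz_op W)^-1%VF r)) (fdsval x) = pairing r x.
Proof. by rewrite -riesz_opE riesz_opVK. Qed.

Lemma sqr_norm_riesz_inv (W : fdsubspace V) (r : dual W) :
  `|fdsval ((riesz_op W)^-1%VF r)| ^+ 2 = pairing r ((riesz_op W)^-1%VF r).
Proof. by rewrite sqr_norm_inner inner_riesz_inv. Qed.

(** The coarse term first applies the adjoint of the inclusion, which restricts [r] to the coarse
    space, where it is zero. *)
Lemma pairing_coarse_correction (W1 W2 : fdsubspace V)
    (W12 : {subset W1 <= W2}) (S : 'Hom(dual W2, W2)) (r : dual W2) :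
    (forall x : W1, pairing r (fdincl W12 x) = 0) ->
  pairing r ((fdincl W12 \o ((riesz_op W1)^-1 \o adjoint (fdincl W12)) + S)%VF r)
  = pairing r (S r).
Proof.
move=> r0; rewrite add_lfunE !comp_lfunE.
have -> : adjoint (fdincl W12) r = 0.
  by apply/lfunP => x; rewrite zero_lfunE; have := adjointE (fdincl W12) r x;
     rewrite r0.
by rewrite !linear0 add0r.
Qed.

End Riesz.

(** Meant for [p], [q] the preconditioner energies and [s], [t] the squared Riesz norms. The upper
    bounds with positive [c3], [c5] force [p] and [q] to be nonnegative, so the weights may be
    replaced by their minimum or maximum. *)
Lemma weighted_sum_bounds (R : realType) (c2 c3 c4 c5 p q s t : R) :
    0 < c3 -> 0 < c5 -> 0 <= s -> 0 <= t ->
    c2 * p <= s -> s <= c3 * p -> c4 * q <= t -> t <= c5 * q ->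
  [/\ 0 <= p + q, Num.min c2 c4 * (p + q) <= s + t
    & s + t <= Num.max c3 c5 * (p + q)].
Proof.
move=> c30 c50 s0 t0 ps sp qt tq.
have p0 : 0 <= p by rewrite -(pmulr_rge0 _ c30) (le_trans s0).
have q0 : 0 <= q by rewrite -(pmulr_rge0 _ c50) (le_trans t0).
split; first exact: addr_ge0.
- rewrite mulrDr lerD // ?(le_trans _ ps) ?(le_trans _ qt) //.
    by rewrite ler_wpM2r // ge_min lexx.
  by rewrite ler_wpM2r // ge_min lexx orbT.
- rewrite mulrDr lerD // ?(le_trans sp) ?(le_trans tq) //.
    by rewrite ler_wpM2r // le_max lexx.
  by rewrite ler_wpM2r // le_max lexx orbT.
Qed.

Theorem theorem4p1 (R : realType) (Sigma U : hilbertType R)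
  (a : {bilinear Sigma -> Sigma -> R | *%R & *%R})
  (b : {bilinear Sigma -> U -> R | *%R & *%R})
  (g : {scalar Sigma}) (f : {scalar U})
  (a_bounded : bounded_bilinear a) (a_sym : forall x y, a x y = a y x)
  (b_bounded : bounded_bilinear b)
  (g_continuous : continuous (g : Sigma -> R))
  (f_continuous : continuous (f : U -> R))
  (Sh Sh2 : fdsubspace Sigma) (Uh Uh2 : fdsubspace U)
  (Sh_sub : {subset Sh <= Sh2}) (Uh_sub : {subset Uh <= Uh2})
  (sigma : Sigma) (u : U)
  (sigma_u_eq1 : forall tau : Sigma, a sigma tau + b tau u = g tau)
  (sigma_u_eq2 : forall v : U, b sigma v = f v)
  (sigmah : Sh) (uh : Uh)
  (sigmah_uh_eq1 : forall tau : Sh,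
    a (fdsval sigmah) (fdsval tau) + b (fdsval tau) (fdsval uh) = g (fdsval tau))
  (sigmah_uh_eq2 : forall v : Uh, b (fdsval sigmah) (fdsval v) = f (fdsval v))
  (sigmah2 : Sh2) (uh2 : Uh2)
  (sigmah2_uh2_eq1 : forall tau : Sh2,
    a (fdsval sigmah2) (fdsval tau) + b (fdsval tau) (fdsval uh2)
    = g (fdsval tau))
  (sigmah2_uh2_eq2 : forall v : Uh2,
    b (fdsval sigmah2) (fdsval v) = f (fdsval v))
  (alpha beta : R) (alpha_gt0 : 0 < alpha) (beta_gt0 : 0 < beta)
  (boundedness : forall (tau1 tau2 : Sh2) (v1 v2 : Uh2),
    saddle_form a b (fdsval tau1, fdsval v1) (fdsval tau2, fdsval v2)
    <= alpha * prod_norm (fdsval tau1) (fdsval v1)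
             * prod_norm (fdsval tau2) (fdsval v2))
  (infsup : forall (tau1 : Sh2) (v1 : Uh2),
    beta * prod_norm (fdsval tau1) (fdsval v1)
    <= sup [set saddle_form a b (fdsval tau1, fdsval v1)
                                (fdsval q.1, fdsval q.2)
           | q in [set q : Sh2 * Uh2
                  | prod_norm (fdsval q.1) (fdsval q.2) = 1]])
  (gamma : R) (gamma_ge0 : 0 <= gamma) (gamma_lt1 : gamma < 1)
  (saturation : prod_norm (sigma - fdsval sigmah2) (u - fdsval uh2)
    <= gamma * prod_norm (sigma - fdsval sigmah) (u - fdsval uh))
  (SSigma : 'Hom(dual Sh2, Sh2)) (SU : 'Hom(dual Uh2, Uh2))
  (BSigma : 'Hom(dual Sh2, Sh2)) (BU : 'Hom(dual Uh2, Uh2))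
  (BSigma_def : BSigma =
    (fdincl Sh_sub \o ((riesz_op Sh)^-1 \o adjoint (fdincl Sh_sub)) + SSigma)%VF)
  (BU_def : BU =
    (fdincl Uh_sub \o ((riesz_op Uh)^-1 \o adjoint (fdincl Uh_sub)) + SU)%VF)
  (c2 c3 c4 c5 : R) (c2_gt0 : 0 < c2) (c3_gt0 : 0 < c3)
  (c4_gt0 : 0 < c4) (c5_gt0 : 0 < c5)
  (precond_Sigma : forall r1 : dual Sh2,
    c2 * pairing r1 (BSigma r1) <= pairing r1 ((riesz_op Sh2)^-1%VF r1)
    /\ pairing r1 ((riesz_op Sh2)^-1%VF r1) <= c3 * pairing r1 (BSigma r1))
  (precond_U : forall r2 : dual Uh2,
    c4 * pairing r2 (BU r2) <= pairing r2 ((riesz_op Uh2)^-1%VF r2)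
    /\ pairing r2 ((riesz_op Uh2)^-1%VF r2) <= c5 * pairing r2 (BU r2))
  (rsigma : dual Sh2) (ru : dual Uh2)
  (rsigma_def : forall tau : Sh2, pairing rsigma tau =
    g (fdsval tau) - a (fdsval sigmah) (fdsval tau)
    - b (fdsval tau) (fdsval uh))
  (ru_def : forall v : Uh2, pairing ru v =
    f (fdsval v) - b (fdsval sigmah) (fdsval v)) :
  let err := prod_norm (sigma - fdsval sigmah) (u - fdsval uh) in
  let Eh := Num.sqrt (pairing rsigma (BSigma rsigma) + pairing ru (BU ru)) in
  [/\ Num.sqrt (Num.min c2 c4) / (alpha * (1 + gamma)) * Eh <= err,
      err <= Num.sqrt (Num.max c3 c5) / (beta * (1 - gamma)) * Eh
    & Eh = Num.sqrt (pairing rsigma (SSigma rsigma) + pairing ru (SU ru))].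
Proof.
move=> err Eh.
pose x1 := (riesz_op Sh2)^-1%VF rsigma; pose y1 := (riesz_op Uh2)^-1%VF ru.
pose N := prod_norm (fdsval x1) (fdsval y1).
have [d dE] : exists d : Sh2, fdsval d = fdsval sigmah2 - fdsval sigmah.
  by exists (sigmah2 - fdincl Sh_sub sigmah); rewrite linearB /= fdinclE.
have [e eE] : exists e : Uh2, fdsval e = fdsval uh2 - fdsval uh.
  by exists (uh2 - fdincl Uh_sub uh); rewrite linearB /= fdinclE.
pose M := prod_norm (fdsval d) (fdsval e).
have residualE (tau : Sh2) (v : Uh2) :
    saddle_form a b (fdsval d, fdsval e) (fdsval tau, fdsval v) =
    inner (fdsval x1) (fdsval tau) + inner (fdsval y1) (fdsval v).
  (* The fine Galerkin equations replace [g] and [f] on the fine space; bilinearity does the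
     rest. *)
  rewrite /saddle_form /= !inner_riesz_inv rsigma_def ru_def.
  rewrite -sigmah2_uh2_eq1 -sigmah2_uh2_eq2 dE eE.
  by rewrite !linearBl linearBr /=; ring.
have N_le : N <= alpha * M.
  (* For nonzero [N], testing the residual identity with the representatives themselves gives
     [N ^+ 2 <= alpha * M * N], and one factor [N] cancels. *)
  have [N0|N0] := eqVneq N 0; first
    by rewrite N0 mulr_ge0 ?prod_norm_ge0 ?(ltW alpha_gt0).
  have Npos : 0 < N by rewrite lt_neqAle eq_sym N0 prod_norm_ge0.
  rewrite -(ler_pM2r Npos) -expr2 sqr_prod_norm !sqr_norm_inner -residualE.
  exact: boundedness.
have M_le : beta * M <= N.
  apply: (le_trans (infsup d e)).
  set A := [set _ | _ in _].
  (* The unit sphere is empty when both fine spaces are trivial; the supremum is then 0 by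
     convention. Otherwise Cauchy-Schwarz bounds each of its elements by [N]. *)
  have [->|/set0P A0] := eqVneq A set0; first by rewrite sup0 prod_norm_ge0.
  apply: ge_sup => // _ [[tau v] /= tv1 <-].
  by rewrite residualE -[leRHS]mulr1 -tv1 inner_prod_cauchy.
have telescope (V : zmodType) (x y z : V) : (y - z) + (x - y) = x - z.
  by rewrite addrC subrKA.
have M_le_err : M <= (1 + gamma) * err.
  (* The discrete difference is the coarse error minus the fine error, and saturation bounds the
     latter by [gamma * err]. *)
  have -> : M = prod_norm ((sigma - fdsval sigmah) - (sigma - fdsval sigmah2))
                          ((u - fdsval uh) - (u - fdsval uh2)).
    by rewrite /M dE eE !opprB !telescope.
  apply: le_trans (prod_normD _ _ _ _) _.
  by rewrite prod_normN mulrDl mul1r lerD2l.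
have err_le_M : (1 - gamma) * err <= M.
  have : err <= M + prod_norm (sigma - fdsval sigmah2) (u - fdsval uh2).
    apply: le_trans (prod_normD _ _ _ _).
    by rewrite dE eE !telescope.
  by move: saturation; rewrite -/err; lra.
have [BS1 BS2] := precond_Sigma rsigma; have [BU1 BU2] := precond_U ru.
(* The middle terms of the preconditioner bounds become squared norms of [x1] and [y1], with sum
   [N ^+ 2]. *)
rewrite -sqr_norm_riesz_inv in BS1 BS2; rewrite -sqr_norm_riesz_inv in BU1 BU2.
have [E0 lo up] := weighted_sum_bounds c3_gt0 c5_gt0
  (sqr_ge0 _) (sqr_ge0 _) BS1 BS2 BU1 BU2.
rewrite -sqr_prod_norm -/N in lo up.
have lo_N : Num.sqrt (Num.min c2 c4) * Eh <= N.
  rewrite -sqrtrM ?le_min ?(ltW c2_gt0) ?(ltW c4_gt0) //.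
  by rewrite -[leRHS](ger0_norm (prod_norm_ge0 _ _)) -sqrtr_sqr ler_wsqrtr.
have N_up : N <= Num.sqrt (Num.max c3 c5) * Eh.
  rewrite -sqrtrM ?le_max ?(ltW c3_gt0) //.
  by rewrite -[leLHS](ger0_norm (prod_norm_ge0 _ _)) -sqrtr_sqr ler_wsqrtr.
split.
(* Denominators cleared, the chain is estimator, [N], [alpha * M], [alpha * (1 + gamma) * err]; the
   next bullet runs the reverse chain with [beta] and [1 - gamma]. *)
- rewrite mulrAC ler_pdivrMr ?mulr_gt0 ?ltr_pwDl //.
  apply: (le_trans lo_N); apply: (le_trans N_le).
  by rewrite mulrCA ler_pM2l // mulrC.
- rewrite mulrAC ler_pdivlMr ?mulr_gt0 ?subr_gt0 //.
  apply: le_trans N_up; apply: le_trans M_le.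
  by rewrite mulrCA ler_pM2l // mulrC.
(* The coarse Galerkin equations say that both residuals vanish on the coarse spaces. *)
- rewrite /Eh BSigma_def BU_def !pairing_coarse_correction //.
    by move=> v; rewrite ru_def fdinclE sigmah_uh_eq2 subrr.
  by move=> tau; rewrite rsigma_def fdinclE -sigmah_uh_eq1; ring.
Qed.
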